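(* Let $(X,d)$ be a compact connected metric space and let $L\ge 1$. Suppose that $X$ also carries the structure of a smooth Riemannian manifold with Riemannian metric $g$ and induced distance $d_g$, such that $d$ and $d_g$ are $L$-bi-Lipschitz, i.e. $L^{-1}d(p,q)\le d_g(p,q)\le L\,d(p,q)$ for all $p,q\in X$. Then there exists a sequence $(X_i,d_i)_{i\in\mathbb N}$ of metric spaces such that: (1) $(X_i,d_i)$ converges to $(X,d)$ in the Gromov-Hausdorff distance as $i\to\infty$; (2) for each $i$, $(X_i,d_i)$ is locally isometric to $(X,L d_g)$, where $L d_g$ is the distance $d_g$ multiplied by the constant $L$; (3) for each $i$, $(X_i,d_i)$ is $L$-bi-Lipschitz homeomorphic to $(X,d_g)$.
   Context: Metric spaces $(Y,d_Y)$ and $(Z,d_Z)$ are $L$-bi-Lipschitz homeomorphic, for $L\ge 1$, if there is a homeomorphism $f:Y\to Z$ such that $L^{-1}d_Y(p,q)\le d_Z(f(p),f(q))\le L\,d_Y(p,q)$ for all $p,q\in Y$. The distance $d_g$ induced by a Riemannian metric $g$ is the infimum of $g$-lengths of curves joining two points. A metric space $Y$ is locally isometric to a metric space $Z$ if every point of $Y$ has an open neighborhood which, with the restricted metric, is isometric to an open subset of $Z$ with the restricted metric. The Hausdorff distance between subsets $A,B$ of a metric space is the infimum of $r\ge 0$ such that each of $A,B$ is contained in the open $r$-neighborhood of the other. The Gromov-Hausdorff distance between metric spaces $Y,Z$ is the infimum of the Hausdorff distances between $f(Y)$ and $h(Z)$ over all metric spaces $W$ and isometric embeddings $f:Y\to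 W$, $h:Z\to W$. *)

(* Defs.v *)
(* MathComp-Analysis development over an abstract R : realType. *)
From HB Require Import structures.
From mathcomp Require Import all_boot all_order all_algebra.
From mathcomp Require Import all_classical all_reals all_analysis.

Set Implicit Arguments.
Unset Strict Implicit.
Unset Printing Implicit Defensive.

Import Order.TTheory GRing.Theory Num.Theory.
Import numFieldNormedType.Exports.

Local Open Scope classical_set_scope.
Local Open Scope ring_scope.

(* Bi-Lipschitz maps and local isometries are stated for distance functions    *)
(* dY : Y -> Y -> R rather than for metricType's, because they are applied to  *)
(* two distances (d and d_g) on one carrier; for Y : metricType R the distance *)
(* is [mdist], and [dist_open mdist], [dist_continuous mdist mdist] are the    *)
(* topological notions.                                                        *)
Section Distances.
Context {R : realType}.

Definition dist_open (Y : Type) (dY : Y -> Y -> R) (U : set Y) : Prop :=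
  forall y, U y -> exists2 e : R, 0 < e & forall z, dY y z < e -> U z.

Definition dist_continuous (Y Z : Type) (dY : Y -> Y -> R) (dZ : Z -> Z -> R)
    (f : Y -> Z) : Prop :=
  forall (y : Y) (e : R), 0 < e ->
    exists2 r : R, 0 < r & forall y', dY y y' < r -> dZ (f y) (f y') < e.

Definition bilipschitz_homeomorphic (L : R) (Y Z : Type)
    (dY : Y -> Y -> R) (dZ : Z -> Z -> R) : Prop :=
  exists f : Y -> Z, exists f' : Z -> Y,
    [/\ cancel f f', cancel f' f,
        dist_continuous dY dZ f, dist_continuous dZ dY f' &
        forall p q, L^-1 * dY p q <= dZ (f p) (f q) <= L * dY p q].

Definition locally_isometric (Y Z : Type)
    (dY : Y -> Y -> R) (dZ : Z -> Z -> R) : Prop :=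
  forall y : Y, exists U : set Y, exists f : Y -> Z,
    [/\ U y, dist_open dY U, dist_open dZ (f @` U) &
        forall p q, U p -> U q -> dZ (f p) (f q) = dY p q].

End Distances.

Section GromovHausdorff.
Context {R : realType}.

Definition open_neighborhood (W : metricType R) (A : set W) (r : R) : set W :=
  [set w | exists2 a, A a & mdist a w < r].

(* Infima are taken in \bar R, so that the infimum of the empty set is +oo. *)
Definition hausdorff_dist (W : metricType R) (A B : set W) : \bar R :=
  ereal_inf [set r%:E | r in
    [set r : R | [/\ 0 <= r, A `<=` open_neighborhood B r &
                     B `<=` open_neighborhood A r]]].

Definition isometric_embedding (Y W : metricType R) (f : Y -> W) : Prop :=
  forall p q, mdist (f p) (f q) = mdist p q.

Definition GH_dist (Y Z : metricType R) : \bar R :=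
  ereal_inf [set r : \bar R |
    exists (W : metricType R) (f : Y -> W) (h : Z -> W),
      [/\ isometric_embedding f, isometric_embedding h &
          r = hausdorff_dist (range f) (range h)]].

End GromovHausdorff.

Section Smooth.
Context {R : realType}.

(* On an open set U: all iterated partial derivatives of order at most k exist *)
(* and are continuous.                                                         *)
Fixpoint Ck_on (m : nat) (V : normedModType R) (k : nat) (U : set 'rV[R]_m)
    (f : 'rV[R]_m -> V) : Prop :=
  {in U, continuous f} /\
  if k is k'.+1 then
    forall i : 'I_m,
      {in U, forall x, derivable f x (delta_mx 0 i)} /\
      Ck_on k' U (fun x => 'D_(delta_mx 0 i) f x)
  else True.

Definition smooth_on (m : nat) (V : normedModType R) (U : set 'rV[R]_m)
    (f : 'rV[R]_m -> V) : Prop :=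
  forall k, Ck_on k U f.

End Smooth.

Section Riemannian.
Context {R : realType}.

(* The maps are total; only their values on [chart_dom] and its image matter. *)
Record chart (X : topologicalType) (n : nat) := Chart {
  chart_dom : set X;
  chart_map :> X -> 'rV[R]_n;
  chart_inv : 'rV[R]_n -> X;
  chart_dom_open : open chart_dom;
  chart_img_open : open (chart_map @` chart_dom);
  chart_mapK : {in chart_dom, cancel chart_map chart_inv};
  chart_map_continuous : {within chart_dom, continuous chart_map};
  chart_inv_continuous :
    {within chart_map @` chart_dom, continuous chart_inv} }.

Definition transition (X : topologicalType) (n : nat) (c c' : chart X n) :
  'rV[R]_n -> 'rV[R]_n := c' \o chart_inv c.

(* A smooth n-manifold structure (without boundary) compatible with the        *)
(* topology of X, and a smooth Riemannian metric given by its coordinate       *)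
(* matrices. The Hausdorff and countability axioms are left out: they hold on  *)
(* a compact metric space. Tangent vectors are row vectors, so [jacobian] acts *)
(* on the right and the inner product of v and w in the chart c at x is        *)
(* v *m riem_mx c x *m w^T.                                                    *)
Record riemannian_structure (X : topologicalType) (n : nat) := Riemannian {
  atlas : set (chart X n);
  chart_at : X -> chart X n;
  chart_at_atlas : forall p, atlas (chart_at p);
  chart_at_dom : forall p, chart_dom (chart_at p) p;
  transition_smooth : forall c c', atlas c -> atlas c' ->
    smooth_on (c @` (chart_dom c `&` chart_dom c')) (transition c c');
  riem_mx : chart X n -> 'rV[R]_n -> 'M[R]_n;
  riem_mx_smooth : forall c, atlas c ->
    smooth_on (c @` chart_dom c) (riem_mx c);
  riem_mx_sym : forall c, atlas c -> forall x, (c @` chart_dom c) x ->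
    (riem_mx c x)^T = riem_mx c x;
  riem_mx_posdef : forall c, atlas c -> forall x, (c @` chart_dom c) x ->
    forall v : 'rV[R]_n, v != 0 -> 0 < (v *m riem_mx c x *m v^T) 0 0;
  riem_mx_transition : forall c c', atlas c -> atlas c' ->
    forall x, (c @` (chart_dom c `&` chart_dom c')) x ->
      let J := jacobian (transition c c') x in
      riem_mx c x = J *m riem_mx c' (transition c c' x) *m J^T }.

Section Length.
Context (X : topologicalType) (n : nat) (g : riemannian_structure X n).

Definition C1_curve (I : set R) (gamma : R -> X) : Prop :=
  {in I, continuous gamma} /\
  forall c, atlas g c -> forall t, I t -> chart_dom c (gamma t) ->
    derivable (c \o gamma) t 1 /\
    {for t, continuous (derive1 (c \o gamma))}.

(* [itv_partition a b s] says that a < s_0 < ... < s_k = b (a = b if s is      *)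
(* empty). C^1 on a closed interval means extendable to a C^1 curve on an open *)
(* interval containing it; since the pieces agree with gamma on closed         *)
(* intervals, gamma is continuous on [a, b].                                   *)
Definition piecewise_C1 (a b : R) (gamma : R -> X) : Prop :=
  exists2 s : seq R, itv_partition a b s &
    forall i, (i < size s)%N ->
      let u := nth b (a :: s) i in
      let v := nth b (a :: s) i.+1 in
      exists2 e : R, 0 < e &
        exists2 c : R -> X, C1_curve `]u - e, v + e[ c &
          {in `[u, v], c =1 gamma}.

(* By [riem_mx_transition] the choice of chart is immaterial; at the finitely  *)
(* many breakpoints, where the derivative may not exist, the value is          *)
(* irrelevant to the length.                                                   *)
Definition speed (gamma : R -> X) (t : R) : R :=
  let c := chart_at g (gamma t) in
  let v := derive1 (c \o gamma) t in
  Num.sqrt ((v *m riem_mx g c (c (gamma t)) *m v^T) 0 0).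

Definition curve_length (a b : R) (gamma : R -> X) : \bar R :=
  (\int[lebesgue_measure]_(t in `[a, b]) (speed gamma t)%:E)%E.

(* +oo between points that no piecewise C^1 curve joins. *)
Definition riem_edist (p q : X) : \bar R :=
  ereal_inf [set l | exists (a b : R) (gamma : R -> X),
    [/\ a <= b, piecewise_C1 a b gamma, gamma a = p, gamma b = q &
        l = curve_length a b gamma]].

Definition riem_dist (p q : X) : R := fine (riem_edist p q).

End Length.

End Riemannian.

(* Main.v *)
(* Put D := L d_g, so that d <= D <= L^2 d. Given e > 0, take a maximal
   e-separated set N for D and let d_e(p, q) be the infimum of D(p, q) and of
   the lengths D(p, x) + d(x, y) + D(y, q) with x, y in N. Since d <= D, one
   shortcut is never worse than several, so d_e is a distance, and
   d <= d_e <= D. A shortcut with x <> y costs at least e / L^2, so d_e = D at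
   small scale; and d_e <= d + 4e because N is an e-net for D. Thus (X, d_e)
   is as required, with the identity of X as the homeomorphism. *)
Require Import Defs.
From HB Require Import structures.
From mathcomp Require Import all_boot all_order all_algebra.
From mathcomp Require Import all_classical all_reals all_analysis.
From mathcomp Require Import measurable_realfun ring lra.

Set Implicit Arguments.
Unset Strict Implicit.
Unset Printing Implicit Defensive.

Import Order.TTheory GRing.Theory Num.Theory.
Import numFieldNormedType.Exports.

Local Open Scope classical_set_scope.
Local Open Scope ring_scope.

(** * Distance functions and the metric spaces they define *)

Section Remetrization.
Context {R : realType}.

Record is_distance (T : Type) (d : T -> T -> R) : Prop := IsDistance {
  distance_refl : forall x, d x x = 0;
  distance_separated : forall x y, d x y = 0 -> x = y;
  distance_sym : forall x y, d x y = d y x;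
  distance_triangle : forall y x z, d x z <= d x y + d y z }.

Lemma distance_ge0 (T : Type) (d : T -> T -> R) (dP : is_distance d) x y :
  0 <= d x y.
Proof.
have := distance_triangle dP y x x.
by rewrite (distance_refl dP) (distance_sym dP y x) -mulr2n pmulrn_lge0.
Qed.

(** A copy of [T] indexed by the proof that [d] is a distance, so that one carrier can bear several
    metric structures without clash. *)
Definition remetrized (T : choiceType) (d : T -> T -> R)
  of is_distance d : Type := T.

HB.instance Definition _ (T : choiceType) (d : T -> T -> R)
  (dP : is_distance d) := Choice.on (remetrized dP).

HB.instance Definition _ (T : choiceType) (d : T -> T -> R)
    (dP : is_distance d) :=
  isMetric.Build R (remetrized dP) (distance_refl dP)
    (distance_separated dP) (distance_sym dP) (distance_triangle dP).

End Remetrization.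

Lemma mdist_is_distance {R : realType} (X : metricType R) :
  is_distance (@mdist R X).
Proof.
split=> [||x y|y x z]; [exact: mdistxx|exact: mdist_positivity| |].
- exact: metric_sym.
- exact: metric_triangle.
Qed.

(** * An upper bound for the Gromov-Hausdorff distance *)

Section GromovHausdorffBound.
Context {R : realType}.

Lemma hausdorff_dist_ge0 (W : metricType R) (A B : set W) :
  (0 <= hausdorff_dist A B)%E.
Proof. by apply: le_ereal_inf_tmp => _ [r [r0 _ _] <-]; rewrite lee_fin. Qed.

Lemma GH_dist_ge0 (Y Z : metricType R) : (0 <= GH_dist Y Z)%E.
Proof.
apply: le_ereal_inf_tmp => _ [W [f [h [_ _ ->]]]].
exact: hausdorff_dist_ge0.
Qed.

Variables (T : Type) (d0 d1 : T -> T -> R) (e : R).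
Hypotheses (d0P : is_distance d0) (d1P : is_distance d1) (e_gt0 : 0 < e).
Hypotheses (d01 : forall p q, d0 p q <= d1 p q)
  (d10 : forall p q, d1 p q <= d0 p q + e).

(** The ambient space for the Gromov-Hausdorff bound: two copies of [T], one per distance, hung a
    gap [e] apart. *)
Definition two_sheet_dist (p q : bool * T) : R :=
  match p.1, q.1 with
  | false, false => d0 p.2 q.2
  | true, true => d1 p.2 q.2
  | _, _ => d0 p.2 q.2 + e
  end.

(** In the triangle inequality, a detour through the other sheet pays [e] twice, which covers the
    excess of [d1] over [d0]; a step inside the [d1] sheet is no shorter than its [d0]
    counterpart. *)
Lemma two_sheet_is_distance : is_distance two_sheet_dist.
Proof.
split.
- by case=> [[] x]; rewrite /two_sheet_dist/= ?(distance_refl d0P)//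
    (distance_refl d1P).
- have pos x y : d0 x y + e = 0 -> False.
    by move=> xy; move: (distance_ge0 d0P x y) e_gt0 => *; lra.
  case=> [[] x] [[] y]; rewrite /two_sheet_dist/= => xy; last 3 first.
  + by case: (pos _ _ xy).
  + by case: (pos _ _ xy).
  + by rewrite (distance_separated d0P xy).
  + by rewrite (distance_separated d1P xy).
- by case=> [[] x] [[] y]; rewrite /two_sheet_dist/= ?(distance_sym d0P x)//
    (distance_sym d1P x).
- case=> [[] y] [[] x] [[] z]; rewrite /two_sheet_dist/=;
    have := distance_triangle d0P y x z; have := distance_triangle d1P y x z;
    have := d01 x y; have := d01 y z; have := d10 x z; move: e_gt0; lra.
Qed.

End GromovHausdorffBound.

(** The two copies of a point lie at distance exactly [e]; the bound is [2 * e] because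
    neighborhoods are open and need a strict inequality. *)
Lemma GH_dist_remetrized_le {R : realType} (X : metricType R)
    (d1 : X -> X -> R) (d1P : is_distance d1) (e : R) : 0 < e ->
    (forall p q, mdist p q <= d1 p q) ->
    (forall p q, d1 p q <= mdist p q + e) ->
  (GH_dist (remetrized d1P) X <= (2 * e)%:E)%E.
Proof.
move=> e0 d01 d10.
have d0P := mdist_is_distance X.
pose wP := two_sheet_is_distance d0P d1P e0 d01 d10.
pose W : metricType R := remetrized wP.
pose f : remetrized d1P -> W := fun x => (true, x).
pose h : X -> W := fun x => (false, x).
have fh (x : X) : mdist (f x) (h x) < 2 * e.
  have -> : mdist (f x) (h x) = mdist x x + e by [].
  by rewrite (distance_refl d0P) add0r ltr_pMl// ltr1n.
have hf (x : X) : mdist (h x) (f x) < 2 * e by rewrite metric_sym.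
apply: (@le_trans _ _ (hausdorff_dist (range f) (range h))).
  apply: ge_ereal_inf; exists (hausdorff_dist (range f) (range h)) => //.
  by exists W, f, h.
apply: ge_ereal_inf; exists (2 * e)%:E => //; exists (2 * e) => //.
split; first by rewrite mulr_ge0// ltW.
- by move=> _ [x _ <-]; exists (h x) => //; exists x.
- by move=> _ [x _ <-]; exists (f x) => //; exists x.
Qed.

(** * The distance with shortcuts *)

Section Shortcuts.
Context {R : realType} (T : Type) (d D : T -> T -> R) (N : set T).
Hypotheses (dP : is_distance d) (DP : is_distance D).
Hypothesis dD : forall p q, d p q <= D p q.

Definition shortcut_lengths (p q : T) : set R :=
  [set D p q] `|`
  [set r | exists x y, [/\ N x, N y & r = D p x + d x y + D y q]].

Definition shortcut_dist (p q : T) : R := inf (shortcut_lengths p q).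

Let shortcut_lengths_ge p q r : shortcut_lengths p q r -> d p q <= r.
Proof.
move=> [->|[x [y [_ _ ->]]]]; first exact: dD.
have := distance_triangle dP x p q; have := distance_triangle dP y x q.
by have := dD p x; have := dD y q; lra.
Qed.

Let shortcut_lengths_neq0 p q : shortcut_lengths p q !=set0.
Proof. by exists (D p q); left. Qed.

Let shortcut_dist_le p q r : shortcut_lengths p q r -> shortcut_dist p q <= r.
Proof.
by move=> pqr; apply: ge_inf => //; exists (d p q) => s /shortcut_lengths_ge.
Qed.

Let shortcut_dist_ge p q r : lbound (shortcut_lengths p q) r ->
  r <= shortcut_dist p q.
Proof. by move=> rpq; apply: lb_le_inf. Qed.

Lemma dist_le_shortcut_dist p q : d p q <= shortcut_dist p q.
Proof. by apply: shortcut_dist_ge => r /shortcut_lengths_ge. Qed.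

Lemma shortcut_dist_le_dist p q : shortcut_dist p q <= D p q.
Proof. by apply: shortcut_dist_le; left. Qed.

Lemma shortcut_is_distance : is_distance shortcut_dist.
Proof.
have sd_sym x y r : shortcut_lengths x y r -> shortcut_lengths y x r.
  move=> [->|[u [v [Nu Nv ->]]]]; first by left; exact: distance_sym.
  right; exists v, u; split => //.
  by rewrite (distance_sym DP v) (distance_sym dP u) (distance_sym DP x); lra.
split=> [x|x y xy|x y|y x z].
- apply/eqP; rewrite eq_le -{1}(distance_refl DP x) shortcut_dist_le_dist/=.
  by rewrite -(distance_refl dP x) dist_le_shortcut_dist.
- apply: (distance_separated dP); apply/eqP.
  by rewrite eq_le (distance_ge0 dP) andbT -xy dist_le_shortcut_dist.
- by congr inf; apply/seteqP; split => r /sd_sym.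
(* The two infima on the right are replaced in turn by arbitrary lengths [r] and [s], leaving four
   cases: with or without a shortcut in each half. *)
- rewrite -lerBlDr; apply: shortcut_dist_ge => r xyr.
  rewrite lerBlDr addrC -lerBlDr; apply: shortcut_dist_ge => s yzs.
  rewrite lerBlDr addrC; move: xyr yzs => [->|[u [v [Nu Nv ->]]]].
    move=> [->|[u [v [Nu Nv ->]]]].
      exact: le_trans (shortcut_dist_le_dist _ _) (distance_triangle DP _ _ _).
    apply: (@le_trans _ _ (D x u + d u v + D v z)).
      by apply: shortcut_dist_le; right; exists u, v.
    by have := distance_triangle DP y x u; lra.
  move=> [->|[u' [v' [Nu' Nv' ->]]]].
    apply: (@le_trans _ _ (D x u + d u v + D v z)).
      by apply: shortcut_dist_le; right; exists u, v.
    by have := distance_triangle DP y v z; lra.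
  (* Two shortcuts merge into one from [u] to [v']: the stretch from [v] through [y] to [u'] costs
     at least as much in [D] as in [d]. *)
  apply: (@le_trans _ _ (D x u + d u v' + D v' z)).
    by apply: shortcut_dist_le; right; exists u, v'.
  have := distance_triangle dP u' u v'; have := distance_triangle dP v u u'.
  by have := distance_triangle dP y v u'; have := dD v y; have := dD y u'; lra.
Qed.

(** A shortcut between distinct points costs at least [del], and one from a point to itself is a
    mere detour for [D]; so a value below [del] can only be [D p q]. *)
Lemma shortcut_dist_eq (del : R) :
    (forall x y, N x -> N y -> x <> y -> del <= d x y) ->
  forall p q, shortcut_dist p q < del -> shortcut_dist p q = D p q.
Proof.
move=> sep p q pq; apply/eqP; rewrite eq_le shortcut_dist_le_dist/=.
suff : Num.min del (D p q) <= shortcut_dist p q.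
  by rewrite ge_min leNgt pq.
apply: shortcut_dist_ge => r; rewrite ge_min => -[->|[x [y [Nx Ny ->]]]].
  by rewrite lexx orbT.
have [->|xy] := pselect (x = y).
  by apply/orP; right; rewrite (distance_refl dP) addr0 (distance_triangle DP).
apply/orP; left; have := sep _ _ Nx Ny xy.
by have := distance_ge0 DP p x; have := distance_ge0 DP y q; lra.
Qed.

(** With [x] and [y] in [N] near [p] and [q], the end pieces cost at most [2 * e], and [d x y]
    exceeds [d p q] by at most [2 * e] more. *)
Lemma shortcut_dist_le_add (e : R) :
    (forall p, exists2 x, N x & D p x < e) ->
  forall p q, shortcut_dist p q <= d p q + 4 * e.
Proof.
move=> net p q; have [x Nx px] := net p; have [y Ny qy] := net q.
apply: (@le_trans _ _ (D p x + d x y + D y q)).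
  by apply: shortcut_dist_le; right; exists x, y.
have := distance_triangle dP p x y; have := distance_triangle dP q p y.
have := dD p x; have := dD q y.
by rewrite (distance_sym dP x p) (distance_sym DP y q); lra.
Qed.

End Shortcuts.

(** A separated set maximal under inclusion, given by Zorn, is a net: a point at distance at least
    [e] from all of it could be added. *)
Lemma exists_separated_net {R : realType} (T : Type) (D : T -> T -> R)
    (DP : is_distance D) (e : R) : 0 < e ->
  exists N : set T, (forall x y, N x -> N y -> x <> y -> e <= D x y) /\
    (forall p, exists2 x, N x & D p x < e).
Proof.
move=> e0.
have [F FP totF|N [sepN maxN]] := @Zorn_bigcup T
    [set N | forall x y, N x -> N y -> x <> y -> e <= D x y].
  move=> x y [A FA Ax] [B FB By].
  by case: (totF _ _ FA FB) => [AB|BA]; [apply: (FP _ FB)|apply: (FP _ FA)];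
    auto.
exists N; split => // p; apply: contrapT => farp.
have far x : N x -> e <= D p x.
  by move=> Nx; rewrite leNgt; apply/negP => px; apply: farp; exists x.
have Np : ~ N p by move/far; rewrite (distance_refl DP); lra.
apply: (maxN (N `|` [set p])).
  split; first exact: subsetUl.
  by move/(_ p); apply: contra_not Np; apply; right.
move=> x y [Nx|->] [Ny|->] xy //; first exact: sepN.
- by rewrite (distance_sym DP); exact: far.
- exact: far.
Qed.

(* The speed of a curve is read in the chart [chart_at g], an arbitrary
   function of the point, so it is not obviously measurable. Hence no
   measurability is assumed below: the integral of any nonnegative function is
   the supremum of the integrals of its simple minorants. *)
Section LowerIntegral.
Local Open Scope ereal_scope.
Import HBNNSimple.
Context d (T : measurableType d) (R : realType).
Variable mu : {measure set T -> \bar R}.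
Implicit Types (f : T -> \bar R) (D : set T).

Lemma ge0_integral_le_simple D f y : measurable D -> (forall x, 0 <= f x) ->
    (forall h : {nnsfun T >-> R}, (forall x, (h x)%:E <= (f \_ D) x) ->
      \int[mu]_(x in D) (h x)%:E <= y) ->
  \int[mu]_(x in D) f x <= y.
Proof.
move=> mD f0 hy; rewrite ge0_integralE//; apply: ge_ereal_sup => _ [h hf <-].
(* A nonnegative minorant of the restriction of [f] vanishes outside [D]. *)
have hD : h \_ D = h :> (T -> R).
  apply/funext => x; rewrite patchE; case: ifPn => // xD.
  apply/eqP; rewrite eq_le fun_ge0/= -lee_fin.
  by have := hf x; rewrite patchE (negbTE xD).
by rewrite -hD -integral_nnsfun//; exact: hy.
Qed.

Lemma simple_le_ge0_integral D f (h : {nnsfun T >-> R}) : measurable D ->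
    (forall x, 0 <= f x) -> (forall x, D x -> (h x)%:E <= f x) ->
  \int[mu]_(x in D) (h x)%:E <= \int[mu]_(x in D) f x.
Proof.
move=> mD f0 hf; rewrite integral_nnsfun// ge0_integralE//.
apply: ereal_sup_ubound; exists (proj_nnsfun h mD); last by rewrite mrestrict.
move=> x /=; rewrite -[X in X%:E]/(proj_nnsfun h mD x) -mrestrict !patchE.
by case: ifPn => // xD; apply: hf; rewrite inE in xD.
Qed.

Lemma ge0_le_integral_nomeas D f g : measurable D -> (forall x, 0 <= f x) ->
    (forall x, 0 <= g x) -> (forall x, D x -> f x <= g x) ->
  \int[mu]_(x in D) f x <= \int[mu]_(x in D) g x.
Proof.
move=> mD f0 g0 fg; apply: ge0_integral_le_simple => // h hf.
apply: simple_le_ge0_integral => // x Dx; apply: le_trans (fg _ Dx).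
by have := hf x; rewrite patchE mem_set.
Qed.

(** A simple minorant on the union is measurable, so its integral splits, and it is a minorant on
    each piece. *)
Lemma ge0_integral_setU_le (A B : set T) f : measurable A -> measurable B ->
    [disjoint A & B] -> (forall x, 0 <= f x) ->
  \int[mu]_(x in A `|` B) f x <=
  \int[mu]_(x in A) f x + \int[mu]_(x in B) f x.
Proof.
move=> mA mB AB f0; apply: ge0_integral_le_simple => //.
  exact: measurableU.
move=> h hf; have hf' x : (A `|` B) x -> (h x)%:E <= f x.
  by move=> ABx; have := hf x; rewrite patchE mem_set.
rewrite ge0_integral_setU//; last 2 first.
- by apply/measurable_EFinP/measurable_funTS.
- by move=> x _; rewrite lee_fin.
by apply: leeD; apply: simple_le_ge0_integral => // x ?; apply: hf';
  [left|right].
Qed.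

Lemma ge0_subset_integral_le (A B : set T) f : measurable A -> measurable B ->
    A `<=` B -> (forall x, 0 <= f x) ->
  \int[mu]_(x in A) f x <= \int[mu]_(x in B) f x.
Proof.
move=> mA mB AB f0; apply: ge0_integral_le_simple => // h hf.
apply: (@le_trans _ _ (\int[mu]_(x in B) (h x)%:E)).
  apply: ge0_subset_integral => //.
    by apply/measurable_EFinP/measurable_funTS.
  by move=> x _; rewrite lee_fin.
apply: simple_le_ge0_integral => // x Bx; apply: le_trans (hf x) _.
by rewrite patchE; case: ifPn.
Qed.

End LowerIntegral.

(** * Splitting and reflecting integrals over intervals *)

Section IntegralOverIntervals.
Local Open Scope ereal_scope.
Import HBNNSimple.
Context {R : realType}.
Local Notation mu := (@lebesgue_measure R).
Implicit Types (f : R -> \bar R).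

(** The null set [[set b]] is left out of both intervals, so that the junction of a concatenated
    curve never enters the comparison of speeds. *)
Lemma ge0_integral_itv_split_le f (a b c : R) : (a <= b)%R -> (b <= c)%R ->
    (forall x, 0 <= f x) ->
  \int[mu]_(x in `[a, c]) f x <=
  \int[mu]_(x in `[a, b[) f x + \int[mu]_(x in `]b, c]) f x.
Proof.
move=> ab bc f0.
rewrite (_ : `[a, c]%classic = `[a, b[ `|` ([set b] `|` `]b, c])); last first.
  apply/seteqP; split => x /=; rewrite !in_itv/=.
    move=> /andP[ax xc]; case: (ltgtP x b) => [xb|bx|->].
    - by left; rewrite ax.
    - by right; right; rewrite xc.
    - by right; left.
  move=> [/andP[-> xb]|[->|/andP[bx ->]]].
  - by rewrite (ltW (lt_le_trans xb bc)).
  - by rewrite ab.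
  - by rewrite (le_trans ab (ltW bx)).
apply: le_trans (ge0_integral_setU_le _ _ _ _ _) _ => //.
- exact: measurableU.
- apply/disj_setPS => x /= []; rewrite !in_itv/= => /andP[_ xb].
  by move=> [xE|/andP[bx _]]; move: xb;
    [rewrite xE ltxx|rewrite ltNge (ltW bx)].
rewrite leeD2l//; apply: le_trans (ge0_integral_setU_le _ _ _ _ _) _ => //.
  by apply/disj_setPS => x /= [->]; rewrite in_itv/= ltxx.
by rewrite integral_set1 add0e.
Qed.

(** Lebesgue measure is determined by its values on intervals open on the left and closed on the
    right; reflection moves the closed end to the left and keeps the length. *)
Lemma lebesgue_measure_reflect (k : R) (A : set R) : measurable A ->
  pushforward mu (fun x : R => k - x : measurableTypeR R)%R A = mu A.
Proof.
move=> mA; apply/esym/lebesgue_measure_unique => //=.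
  exact: measurable_funB.
move=> _ _ [[a b]] _ <-.
rewrite /pushforward.
rewrite (_ : _ @^-1` _ = `[(k - b)%R, (k - a)%R[%classic); last first.
  apply/seteqP; split=> x /=; rewrite !in_itv/= => /andP[? ?];
    by apply/andP; split; lra.
rewrite !lebesgue_measure_itv/= !lte_fin ltrD2l ltrN2.
by case: ifP => // _; rewrite -!EFinB; congr EFin; ring.
Qed.

Lemma ge0_integral_reflect_le f (k : R) D : measurable D ->
    (forall x, 0 <= f x) ->
  \int[mu]_(x in (fun x => k - x)%R @^-1` D) f (k - x)%R <=
  \int[mu]_(x in D) f x.
Proof.
move=> mD f0.
pose r : measurableTypeR R -> measurableTypeR R := (fun x => k - x)%R.
have mr : measurable_fun setT r by exact: measurable_funB.
have rK : involutive r by move=> x; rewrite /r subKr.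
have mrD : measurable (r @^-1` D).
  by rewrite -[X in measurable X]setTI; exact: mr.
apply: ge0_integral_le_simple => // h hf.
(* Written as a function of [r x], the integrand fits the change of variables for pushforward
   measures. *)
have -> : \int[mu]_(x in r @^-1` D) (h x)%:E =
    \int[mu]_(x in r @^-1` D) ((fun y => (h (r y))%:E) \o r) x.
  by apply: eq_integral => x _ /=; rewrite rK.
have mhr : measurable_fun D (fun y => (h (r y))%:E).
  by apply/measurable_EFinP/measurable_funTS; exact: measurableT_comp.
have hr0 : {in D, forall y, 0 <= (h (r y))%:E} by move=> y _; rewrite lee_fin.
have <- := ge0_integral_pushforward mr mu mD mhr hr0.
rewrite (eq_measure_integral mu); last first.
  by move=> A mA _; exact: lebesgue_measure_reflect.
(* Back over [D], the reflected simple function lies below [f], because [h] lies below the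
   reflection of [f]. *)
apply: ge0_le_integral_nomeas => // x; first by rewrite lee_fin.
move=> Dx; have rDx : (r @^-1` D) (r x) by rewrite /preimage/= rK.
have := hf (r x); rewrite patchE mem_set//.
by rewrite -[(k - r x)%R]/(r (r x)) rK.
Qed.

End IntegralOverIntervals.

(** * Derivatives under reflection of the parameter *)

Section Reflection.
Context {R : realType}.

Lemma oppr_dnbhs0 : -%R @ (0 : R)^' = (0 : R)^'.
Proof.
have N A : (0 : R)^' A -> (-%R @ (0 : R)^') A.
  rewrite /dnbhs/= /within/= -{1}oppr0 => /nearN; apply: filterS => x + x0.
  by apply; rewrite oppr_eq0.
apply/seteqP; split => A; last exact: N.
move=> /N; rewrite /fmap/= => A0.
apply: (@filterS _ _ _ (fun x => A (- - x))) A0.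
by move=> x; rewrite opprK.
Qed.

Variables (V : normedModType R) (f : R -> V) (k t : R).

(** The difference quotient of the reflected function at [h] is minus that of [f] at [- h], and the
    punctured neighborhoods of 0 are symmetric. *)
Let quotient_reflect :
  (fun h => h^-1 *: (f (k - (h + t)) - f (k - t))) @ (0 : R)^' =
  (- (fun h => h^-1 *: (f (h + (k - t)) - f (k - t)))) @ (0 : R)^'.
Proof.
rewrite -[X in _ = _ @ X]oppr_dnbhs0 -fmap_comp.
set q := fun h => _; set q' := _ \o _; suff -> : q = q' by [].
apply/funext => h; rewrite /q /q' /=.
rewrite [RHS](_ : _ = - ((- h)^-1 *: (f (- h + (k - t)) - f (k - t))))//.
by rewrite invrN scaleNr opprK; congr (_ *: (f _ - _)); ring.
Qed.

Let derivableE (h : R -> V) (s : R) :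
  derivable h s 1 = cvg ((fun e => e^-1 *: (h (e + s) - h s)) @ (0 : R)^').
Proof. by rewrite /derivable; under eq_fun do rewrite /= scaler1. Qed.

Let cvg_reflect l :
  (fun h => h^-1 *: (f (h + (k - t)) - f (k - t))) @ (0 : R)^' --> l ->
  (fun h => h^-1 *: (f (k - (h + t)) - f (k - t))) @ (0 : R)^' --> - l.
Proof. by move=> /cvgN; rewrite quotient_reflect; exact. Qed.

Lemma derivable_reflect :
  derivable f (k - t) 1 -> derivable (fun x => f (k - x)) t 1.
Proof.
rewrite !derivableE => /cvg_ex[l fl]; apply/cvg_ex; exists (- l).
exact: cvg_reflect.
Qed.

Lemma derive1_reflect : derivable f (k - t) 1 ->
  derive1 (fun x => f (k - x)) t = - derive1 f (k - t).
Proof.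
by rewrite derivableE => fk; apply: cvg_lim => //; exact: cvg_reflect.
Qed.

End Reflection.

(* Where f is not derivable, [derive1] takes the junk value 0 on both sides. *)
Lemma derive1_rV_reflect {R : realType} (n : nat) (f : R -> 'rV[R]_n)
    (k t : R) :
  derive1 (fun x => f (k - x)) t = - derive1 f (k - t).
Proof.
have [df|df] := pselect (derivable f (k - t) 1); first exact: derive1_reflect.
have dfr : ~ derivable (fun x => f (k - x)) t 1.
  apply: contra_not df; rewrite -{1}[t](subKr k) => /derivable_reflect.
  by under eq_fun do rewrite subKr.
have derive1_junk (h : R -> 'rV[R]_n) s : ~ derivable h s 1 -> derive1 h s = 0.
  move=> dh; rewrite derive1E /derive /lim /lim_in.
  rewrite xgetPN; first by apply/matrixP => i j; rewrite !mxE.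
  by move=> l hl; apply: dh; apply/cvg_ex; exists l.
by rewrite !derive1_junk// oppr0.
Qed.

Lemma near_eq_derive1 {R : realType} (V : normedModType R) (f g : R -> V) t :
  (\near t, f t = g t) -> derive1 f t = derive1 g t.
Proof. by move=> fg; rewrite !derive1E; apply: near_eq_derive. Qed.

(** * Speed, arcs and lengths of curves *)

Section Curves.
Context {R : realType} (X : topologicalType) (n : nat).
Variable g : riemannian_structure (R := R) X n.
Implicit Types (gamma : R -> X) (a b c u v k t : R).

Local Notation refl k gamma := (fun t => gamma (k - t)).

Lemma speed_ge0 gamma t : 0 <= speed g gamma t.
Proof. exact: sqrtr_ge0. Qed.

Lemma near_eq_speed gamma gamma' t :
  (\near t, gamma t = gamma' t) -> speed g gamma t = speed g gamma' t.
Proof.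
move=> gg'; rewrite /speed (nbhs_singleton gg').
rewrite (@near_eq_derive1 _ _ _ (chart_at g (gamma' t) \o gamma'))//.
by apply: filterS gg' => s /= ->.
Qed.

(** The velocity changes sign, which the quadratic form of the metric does not see; this covers also
    the points without derivative. *)
Lemma speed_reflect gamma k t :
  speed g (refl k gamma) t = speed g gamma (k - t).
Proof.
rewrite /speed; set c := chart_at g _.
rewrite (derive1_rV_reflect (c \o gamma)).
by rewrite linearN mulNmx mulNmx mulmxN opprK.
Qed.

Let continuous_reflect k : continuous (fun t => k - t).
Proof. by move=> t; apply: cvgB; [exact: cvg_cst|exact: cvg_id]. Qed.

Lemma C1_curve_reflect (I J : set R) gamma k :
    (forall t, J t -> I (k - t)) ->
  C1_curve g I gamma -> C1_curve g J (refl k gamma).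
Proof.
move=> JI [cgamma dgamma]; split.
  move=> t; rewrite inE => /JI It; apply: continuous_comp.
    exact: continuous_reflect.
  by apply: cgamma; rewrite inE.
move=> c gc t /JI It ct; have [d1 d2] := dgamma _ gc _ It ct; split.
  exact: (derivable_reflect d1).
have -> : derive1 (c \o refl k gamma) =
    (fun s => - derive1 (c \o gamma) (k - s)).
  by apply/funext => s; rewrite -derive1_rV_reflect.
apply: cvgN; apply: (continuous_comp (f := fun s => k - s)) d2.
exact: continuous_reflect.
Qed.

Definition C1_arc gamma u v : Prop :=
  exists2 e : R, 0 < e &
    exists2 c : R -> X, C1_curve g `]u - e, v + e[ c &
      {in `[u, v], c =1 gamma}.

Lemma C1_arc_reflect gamma k u v :
  C1_arc gamma u v -> C1_arc (refl k gamma) (k - v) (k - u).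
Proof.
move=> [e e0 [c cc cg]]; exists e => //; exists (refl k c).
  apply: C1_curve_reflect cc => t /=; rewrite !in_itv/= => /andP[? ?].
  by apply/andP; split; lra.
move=> t; rewrite in_itv/= => /andP[? ?]; apply: cg; rewrite in_itv/=.
by apply/andP; split; lra.
Qed.

Lemma eq_C1_arc gamma gamma' u v : {in `[u, v], gamma =1 gamma'} ->
  C1_arc gamma u v -> C1_arc gamma' u v.
Proof.
move=> gg' [e e0 [c cc cg]]; exists e => //; exists c => // t tuv.
by rewrite cg// gg'.
Qed.

(** An inductive form of [piecewise_C1], allowing induction on the pieces in place of indices into
    the list of breakpoints. *)
Inductive C1_chain gamma : R -> R -> Prop :=
| C1_chain_nil a : C1_chain gamma a a
| C1_chain_cons a u b : a < u -> C1_arc gamma a u -> C1_chain gamma u b ->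
    C1_chain gamma a b.

Lemma piecewise_C1P a b gamma : piecewise_C1 g a b gamma <-> C1_chain gamma a b.
Proof.
split.
  move=> [s]; elim: s a => [|u s IH] a [/= pas lb] arcs.
    by move/eqP: lb => /= <-; exact: C1_chain_nil.
  move: pas => /andP[au us]; apply: (C1_chain_cons au (arcs 0%N isT)).
  by apply: IH => // i si; exact: (arcs i.+1 si).
elim=> {a b} [a|a u b au arc _ [s [pus lb] arcs]].
  by exists [::].
exists (u :: s) => [|[|i] si]; first by split => //=; rewrite au.
  exact: arc.
exact: (arcs i si).
Qed.

Lemma C1_chain_le a b gamma : C1_chain gamma a b -> a <= b.
Proof. by elim=> {a b} // a u b au _ _ ub; exact: le_trans (ltW au) ub. Qed.

Lemma C1_chain_cat a b c gamma :
  C1_chain gamma a b -> C1_chain gamma b c -> C1_chain gamma a c.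
Proof.
by elim=> {a b} // a u b au arc _ IH /IH; exact: C1_chain_cons.
Qed.

Lemma eq_C1_chain a b gamma gamma' : {in `[a, b], gamma =1 gamma'} ->
  C1_chain gamma a b -> C1_chain gamma' a b.
Proof.
move=> + gab; elim: gab => {a b} [a _|a u b au arc ub IH gg'].
  exact: C1_chain_nil.
have ub' := C1_chain_le ub; apply: (C1_chain_cons au).
  apply: eq_C1_arc arc => t; rewrite in_itv/= => /andP[? ?]; apply: gg'.
  by rewrite in_itv/=; apply/andP; split => //; lra.
apply: IH => t; rewrite in_itv/= => /andP[? ?]; apply: gg'.
by rewrite in_itv/=; apply/andP; split => //; lra.
Qed.

(** Reflection reverses the order of the pieces, so the reflected first arc is appended at the
    end. *)
Lemma C1_chain_reflect a b k gamma :
  C1_chain gamma a b -> C1_chain (refl k gamma) (k - b) (k - a).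
Proof.
elim=> {a b} [a|a u b au arc _ IH]; first exact: C1_chain_nil.
apply: (C1_chain_cat IH); apply: C1_chain_cons (C1_chain_nil _ _).
  by rewrite ltrD2l ltrN2.
exact: C1_arc_reflect.
Qed.

Lemma curve_length_ge0 a b gamma : (0 <= curve_length g a b gamma)%E.
Proof. by apply: integral_ge0 => t _; rewrite lee_fin speed_ge0. Qed.

Lemma curve_length_reflect_le a b k gamma :
  (curve_length g (k - b)%R (k - a)%R (refl k gamma) <=
   curve_length g a b gamma)%E.
Proof.
rewrite /curve_length.
under eq_integral do rewrite speed_reflect.
rewrite (_ : `[k - b, k - a]%classic = (fun t => k - t) @^-1` `[a, b]).
  apply: (@ge0_integral_reflect_le _ (fun t => (speed g gamma t)%:E)) => //.
  by move=> x; rewrite lee_fin speed_ge0.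
by apply/seteqP; split=> x /=; rewrite !in_itv/=; move=> /andP[? ?];
  apply/andP; split; lra.
Qed.

Definition concat b gamma gamma' : R -> X :=
  fun t => if t <= b then gamma t else gamma' t.

Lemma concatl b gamma gamma' t : t <= b -> concat b gamma gamma' t = gamma t.
Proof. by rewrite /concat => ->. Qed.

Lemma concatr b gamma gamma' t : gamma b = gamma' b -> b <= t ->
  concat b gamma gamma' t = gamma' t.
Proof.
by move=> gb bt; rewrite /concat; case: (ltgtP t b) bt => // ->.
Qed.

Lemma C1_chain_concat a b c gamma gamma' : gamma b = gamma' b ->
    C1_chain gamma a b -> C1_chain gamma' b c ->
  C1_chain (concat b gamma gamma') a c.
Proof.
move=> gb ab bc; apply: (@C1_chain_cat _ b).
  by apply: eq_C1_chain ab => t; rewrite in_itv/= => /andP[_ tb];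
    rewrite concatl.
by apply: eq_C1_chain bc => t; rewrite in_itv/= => /andP[bt _];
  rewrite concatr.
Qed.

(** At each time other than [b], the concatenation agrees locally with one of the two curves and so
    has its speed. *)
Lemma curve_length_concat_le a b c gamma gamma' : a <= b -> b <= c ->
  (curve_length g a c (concat b gamma gamma') <=
   curve_length g a b gamma + curve_length g b c gamma')%E.
Proof.
move=> ab bc; have sge0 f x : (0 <= (speed g f x)%:E)%E.
  by rewrite lee_fin speed_ge0.
apply: (le_trans (@ge0_integral_itv_split_le _
  (fun t => (speed g (concat b gamma gamma') t)%:E) _ _ _ ab bc (sge0 _))).
have speedl t : t < b ->
    speed g (concat b gamma gamma') t = speed g gamma t.
  move=> tb; apply: near_eq_speed; near=> s.
  by rewrite concatl//; apply/ltW; near: s; exact: lt_nbhsl.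
have speedr t : b < t ->
    speed g (concat b gamma gamma') t = speed g gamma' t.
  move=> bt; apply: near_eq_speed; near=> s.
  have bs : b < s by near: s; exact: lt_nbhsr.
  by rewrite /concat leNgt bs.
apply: leeD.
  rewrite (eq_integral (fun t : measurableTypeR R => (speed g gamma t)%:E)).
    apply: ge0_subset_integral_le => //.
    by apply: subset_itvl; rewrite bnd_simp.
  by move=> t /set_mem/andP[_ tb]; rewrite speedl.
rewrite (eq_integral (fun t : measurableTypeR R => (speed g gamma' t)%:E)).
  apply: ge0_subset_integral_le => //.
  by apply: subset_itvr; rewrite bnd_simp.
by move=> t /set_mem/andP[bt _]; rewrite speedr.
Unshelve. all: by end_near. Qed.

(** * Symmetry and triangle inequality of the Riemannian distance *)

Local Notation dE := (riem_edist g).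

Lemma riem_edist_ge0 p q : (0 <= dE p q)%E.
Proof.
apply: le_ereal_inf_tmp => _ [a [b [gamma [_ _ _ _ ->]]]].
exact: curve_length_ge0.
Qed.

Lemma riem_edist_sym_le p q : (dE p q <= dE q p)%E.
Proof.
apply: le_ereal_inf_tmp => _ [a [b [gamma [ab /piecewise_C1P gab ga gb ->]]]].
apply: ge_ereal_inf; exists (curve_length g (0 - b) (0 - a) (refl 0 gamma)).
  exists (0 - b), (0 - a), (refl 0 gamma); split => //.
  - by rewrite lerD2l lerN2.
  - by apply/piecewise_C1P; exact: C1_chain_reflect.
  - by rewrite subKr.
  - by rewrite subKr.
exact: curve_length_reflect_le.
Qed.

Lemma riem_edist_sym p q : dE p q = dE q p.
Proof. by apply/eqP; rewrite eq_le !riem_edist_sym_le. Qed.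

Lemma riem_edist_concat_le p q r a b gamma c d gamma' :
    C1_chain gamma a b -> gamma a = p -> gamma b = q ->
    C1_chain gamma' c d -> gamma' c = q -> gamma' d = r ->
  (dE p r <= curve_length g a b gamma + curve_length g c d gamma')%E.
Proof.
move=> gab ga gb g'cd g'c g'd.
(* Reflecting twice translates [gamma'] so that it starts at [b]. *)
pose gs := refl 0 (refl (c - b) gamma').
have transcE : 0 - (c - b - c) = b by ring.
have translE : 0 - (c - b - d) = d + b - c by ring.
have gs_chain : C1_chain gs b (d + b - c).
  by rewrite -{1}transcE -translE; do 2 apply: C1_chain_reflect.
have gsb : gs b = q by rewrite /gs -g'c; congr gamma'; ring.
have gsd : gs (d + b - c) = r by rewrite /gs -g'd; congr gamma'; ring.
have gs_len :
    (curve_length g b (d + b - c)%R gs <= curve_length g c d gamma')%E.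
  rewrite -{1}transcE -translE.
  apply: le_trans (curve_length_reflect_le _ _ _ _) _.
  exact: curve_length_reflect_le.
apply: ge_ereal_inf.
exists (curve_length g a (d + b - c) (concat b gamma gs)).
  exists a, (d + b - c), (concat b gamma gs); split => //.
  - exact: le_trans (C1_chain_le gab) (C1_chain_le gs_chain).
  - by apply/piecewise_C1P; apply: C1_chain_concat => //; rewrite gb.
  - by rewrite concatl// (C1_chain_le gab).
  - by rewrite concatr ?gb// (C1_chain_le gs_chain).
apply: (@le_trans _ _
    (curve_length g a b gamma + curve_length g b (d + b - c)%R gs)%E).
  by apply: curve_length_concat_le;
    [exact: C1_chain_le gab|exact: C1_chain_le gs_chain].
by rewrite leeD2l.
Qed.

(** Finiteness of both infima yields curves within [e / 2] of each, which are then concatenated. *)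
Lemma riem_edist_triangle q p r : dE p q \is a fin_num ->
  dE q r \is a fin_num -> (dE p r <= dE p q + dE q r)%E.
Proof.
move=> pq_fin qr_fin; apply/lee_addgt0Pr => e e0.
have e20 : 0 < e / 2 by rewrite divr_gt0.
have [_ [a [b [f [_ /piecewise_C1P fab fa fb ->]]]] fl] :=
  lb_ereal_inf_adherent e20 pq_fin.
have [_ [c [d [h [_ /piecewise_C1P hcd hc hd ->]]]] hl] :=
  lb_ereal_inf_adherent e20 qr_fin.
apply: le_trans (riem_edist_concat_le fab fa fb hcd hc hd) _.
by apply: le_trans (leeD (ltW fl) (ltW hl)) _; rewrite addeACA -EFinD -splitr.
Qed.

End Curves.

(** * The approximating spaces *)

Theorem theorem2 (R : realType) (X : metricType R) (L : R)
    (n : nat) (g : riemannian_structure X n)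
    (X_compact : compact [set: X]) (X_connected : connected [set: X])
    (L_ge1 : 1 <= L)
    (d_dg_bilipschitz : forall p q : X,
      ((L^-1 * mdist p q)%:E <= riem_edist g p q)%E /\
      (riem_edist g p q <= (L * mdist p q)%:E)%E) :
  exists Xi : nat -> metricType R,
    [/\ (fun i => GH_dist (Xi i) X) @ \oo --> 0%E,
        forall i, locally_isometric (@mdist R (Xi i))
                    (fun p q : X => L * riem_dist g p q) &
        forall i, bilipschitz_homeomorphic L (@mdist R (Xi i))
                    (riem_dist g)].
Proof.
have L_gt0 : 0 < L by exact: lt_le_trans L_ge1.
(* The Lipschitz bound excludes the value [+oo], so [fine] loses nothing. *)
have edist_fin p q : riem_edist g p q \is a fin_num.
  rewrite ge0_fin_numE ?riem_edist_ge0//.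
  exact: le_lt_trans (d_dg_bilipschitz p q).2 (ltry _).
have edistE p q : riem_edist g p q = (riem_dist g p q)%:E by rewrite fineK.
pose d := @mdist R X; pose dg : X -> X -> R := riem_dist g.
pose D (p q : X) := L * dg p q.
have dgd p q : dg p q <= L * d p q.
  by rewrite -lee_fin -edistE; exact: (d_dg_bilipschitz p q).2.
have dD p q : d p q <= D p q.
  rewrite /D -ler_pdivrMl//.
  by rewrite -lee_fin -edistE; exact: (d_dg_bilipschitz p q).1.
have dP : is_distance d := mdist_is_distance X.
have DP : is_distance D.
  (* Reflexivity and separation come from the comparison with [d], symmetry and the triangle
     inequality from [riem_edist]. *)
  split=> [x|x y xy|x y|y x z].
  - apply/eqP; rewrite eq_le; apply/andP; split.
      rewrite /D pmulr_rle0// (le_trans (dgd x x))//.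
      by rewrite (distance_refl dP) mulr0.
    by rewrite (le_trans _ (dD x x))// (distance_ge0 dP).
  - apply: (distance_separated dP); apply/eqP.
    by rewrite eq_le (distance_ge0 dP) andbT -xy dD.
  - by rewrite /D /dg /riem_dist riem_edist_sym.
  - rewrite /D -mulrDr ler_pM2l// -lee_fin EFinD -!edistE.
    exact: riem_edist_triangle.
pose eps i : R := (i.+1%:R)^-1.
have eps_gt0 i : 0 < eps i by rewrite invr_gt0.
have net i := exists_separated_net DP (eps_gt0 i).
pose N i := projT1 (cid (net i)).
(* The net is separated for [D]; since [D] is at most [L ^+ 2] times [d], it is separated for [d]
   with the constant divided by [L ^+ 2]. *)
have sepN i x y : N i x -> N i y -> x <> y -> eps i / L ^+ 2 <= d x y.
  move=> Nx Ny xy; rewrite ler_pdivrMr ?exprn_gt0//.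
  apply: le_trans ((projT2 (cid (net i))).1 _ _ Nx Ny xy) _.
  by rewrite /D (mulrC (d x y)) expr2 -mulrA ler_pM2l.
have netN i := (projT2 (cid (net i))).2.
have sP i := shortcut_is_distance (N i) dP DP dD.
exists (fun i => remetrized (sP i)); split.
(* The 8 is the 4 of the net estimate times the 2 of the Gromov-Hausdorff bound. *)
- have upper : (fun i => (8 * eps i)%:E) @ \oo --> 0%E.
    apply: cvg_EFin; first exact: nearW.
    rewrite -[X in _ --> X](mulr0 (8 : R)); apply: cvgM; first exact: cvg_cst.
    exact: cvg_harmonic.
  apply: (squeeze_cvge _ (cvg_cst _) upper).
  apply: nearW => i; rewrite GH_dist_ge0/=.
  rewrite (_ : 8 * eps i = 2 * (4 * eps i)); last by ring.
  apply: GH_dist_remetrized_le; first by rewrite mulr_gt0.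
  + exact: dist_le_shortcut_dist.
  + exact: shortcut_dist_le_add (netN i).
- move=> i y; pose del := eps i / L ^+ 2.
  have del_gt0 : 0 < del by rewrite divr_gt0// exprn_gt0.
  pose s := shortcut_dist d D (N i).
  have sE p q : s p q < del -> s p q = D p q.
    by apply: shortcut_dist_eq => //; exact: sepN.
  have sD p q : s p q <= D p q by exact: shortcut_dist_le_dist.
  (* Two points of this ball have [D]-distance below [del]; as [s] is at most [D], it is below [del]
     too and hence equals [D] on the ball. *)
  exists [set z | D y z < del / 2], id; split => /=.
  + by rewrite (distance_refl DP) divr_gt0.
  + move=> z /= yz; exists (Num.min del (del / 2 - D y z)).
      by rewrite lt_min del_gt0 subr_gt0.
    move=> w zw; have : s z w < Num.min del (del / 2 - D y z) := zw.
    rewrite lt_min => /andP[/sE ->].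
    by have := distance_triangle DP z y w; lra.
  + rewrite image_id => z /= yz; exists (del / 2 - D y z).
      by rewrite subr_gt0.
    by move=> w; have := distance_triangle DP z y w; rewrite /D /dg; lra.
  + move=> p q yp yq; apply/esym/(sE p q).
    apply: le_lt_trans (sD _ _) _.
    have := distance_triangle DP y p q; rewrite (distance_sym DP p y); lra.
- move=> i; pose s := shortcut_dist d D (N i).
  have ds p q : d p q <= s p q by exact: dist_le_shortcut_dist.
  have sD p q : s p q <= D p q by exact: shortcut_dist_le_dist.
  have dgs p q : dg p q <= L * s p q.
    by apply: le_trans (dgd p q) _; rewrite ler_pM2l.
  (* For the identity, [L^-1 * s <= dg] amounts to [s <= D], and [dg <= L * s] is [dgs]. Each
     distance being at most [L] times the other, [e / L] serves for continuity both ways. *)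
  exists id, id; split => //.
  + move=> y e e0; exists (e / L); first by rewrite divr_gt0.
    move=> z; rewrite ltr_pdivlMr// mulrC; exact: le_lt_trans.
  + move=> y e e0; exists (e / L); first by rewrite divr_gt0.
    move=> z; rewrite ltr_pdivlMr// mulrC; exact: le_lt_trans.
  + move=> p q; rewrite ler_pdivrMl//; apply/andP; split; first exact: sD.
    exact: dgs.
Qed.
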